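(* Suppose that each $f_j$ is $m$-smooth and consider LSVRG-inv (defined in the context) with stepsize $\alpha=\min_j\frac1{4\frac m\delta+\frac\sigma{p_j}}$. Then its iteration complexity is $\max_j\left(4\frac m{\sigma\delta}+\frac1{p_j}\right)\log\frac1\epsilon$; that is, there exists $b\in\mathbb R^n$ with positive entries such that, with $$\Psi^k=\|x^k-x^*\|^2+\frac\alpha m\sum_{j=1}^nb_j^2\left\|\nabla f_j(\phi_j^k)-\nabla f_j(x^* )\right\|^2,$$ for every $\epsilon\in(0,1)$ and every integer $k\ge\max_j\left(4\frac m{\sigma\delta}+\frac1{p_j}\right)\log\frac1\epsilon$ we have $\mathbb E[\Psi^k]\le\epsilon\,\Psi^0$.
   Context: Problem. $f_1,\dots,f_n:\mathbb R^d\to\mathbb R$ are differentiable and convex, $f=\frac1n\sum_{j=1}^n f_j$, $\psi:\mathbb R^d\to\mathbb R\cup\{+\infty\}$ is proper, closed and convex. $\min_x f(x)+\psi(x)$ has a unique minimizer $x^*$, and $f$ is $\sigma$-quasi strongly convex with $\sigma>0$: $f(x^* )\ge f(y)+\langle\nabla f(y),x^*-y\rangle+\frac\sigma2\|y-x^*\|^2$ for all $y$. $m$-smoothness of $f_j$ ($m>0$) means $f_j(x)\le f_j(y)+\langle\nabla f_j(y),x-y\rangle+\frac m2\|x-y\|^2$ for all $x,y$. $\mathrm{prox}_{\alpha\psi}(x)=\arg\min_u\{\alpha\psi(u)+\frac12\|u-x\|^2\}$. Sampling. $R$ is a random subset of $[n]$ with arbitrary distribution such that $p_j=\mathbb P(j\in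 R)>0$ for all $j$; $\delta\in(0,1]$. Algorithm (LSVRG-inv). Given $x^0\in\mathbb R^d$, set $\phi_j^0=x^0$ for all $j$. For $k=0,1,2,\dots$ (with randomness independent of the past): $g^k=\frac1n\sum_{j=1}^n\nabla f_j(\phi_j^k)$ with probability $1-\delta$, and $g^k=\frac1\delta\nabla f(x^k)-\left(\frac1\delta-1\right)\frac1n\sum_{j=1}^n\nabla f_j(\phi_j^k)$ with probability $\delta$; $x^{k+1}=\mathrm{prox}_{\alpha\psi}(x^k-\alpha g^k)$; draw an independent copy $R^k$ of $R$ and set $\phi_j^{k+1}=x^k$ if $j\in R^k$, $\phi_j^{k+1}=\phi_j^k$ otherwise. *)

(* Defs.v *)
From mathcomp Require Import all_boot all_order all_algebra.
From mathcomp Require Import all_classical all_reals all_analysis.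

Set Implicit Arguments.
Unset Strict Implicit.
Unset Printing Implicit Defensive.
Import Order.TTheory GRing.Theory Num.Theory.
Import numFieldNormedType.Exports.

Local Open Scope classical_set_scope.
Local Open Scope ring_scope.

(* The norm [`|x|] of MathComp-Analysis on matrices is the sup norm, so the
   Euclidean structure on ['rV[R]_d] is introduced explicitly; topology and
   differentiability do not depend on this choice. *)

Section Euclidean.
Context {R : realType} {d : nat}.
Implicit Types x y : 'rV[R]_d.

Definition dotprod x y : R := \sum_i x 0 i * y 0 i.

Definition sqnorm x : R := dotprod x x.

Definition grad (f : 'rV[R]_d -> R) x : 'rV[R]_d :=
  \row_i 'D_(delta_mx 0 i) f x.

End Euclidean.

Section Functions.
Context {R : realType} {d : nat}.
Implicit Types (f : 'rV[R]_d -> R) (psi : 'rV[R]_d -> \bar R).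

Definition smooth (m : R) f := forall x y : 'rV[R]_d,
  f x <= f y + dotprod (grad f y) (x - y) + m / 2 * sqnorm (x - y).

Definition quasi_strongly_convex (sigma : R) f (xstar : 'rV[R]_d) := forall y,
  f y + dotprod (grad f y) (xstar - y) + sigma / 2 * sqnorm (y - xstar)
    <= f xstar.

Definition proper_function psi :=
  (forall x, psi x != -oo%E) /\ exists x, (psi x < +oo)%E.

Definition closed_function psi :=
  closed [set z : 'rV[R]_d * R | (psi z.1 <= z.2%:E)%E].

(* Restricting to [0 < t < 1] avoids products of the form 0 * +oo. *)
Definition econvex psi := forall (x y : 'rV[R]_d) (t : R), 0 < t < 1 ->
  (psi (t *: x + (1 - t) *: y)%R <= t%:E * psi x + (1 - t)%:E * psi y)%E.

Definition argmin (F : 'rV[R]_d -> \bar R) : set 'rV[R]_d :=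
  [set u | forall v, (F u <= F v)%E].

(* The default value 0 is only used if the minimization problem has no
   solution, which cannot happen for [0 < a] and [psi] proper, closed and
   convex. *)
Definition prox (a : R) psi (x : 'rV[R]_d) : 'rV[R]_d :=
  xget 0 (argmin (fun u => a%:E * psi u + (2^-1 * sqnorm (u - x))%:E)%E).

End Functions.

Section FiniteExtrema.
Context {R : realType} {n : nat} (n_gt0 : (0 < n)%N).

(* There is no neutral element for min and max in [R]; the fold starts from
   the value at the first index. *)
Definition minI (F : 'I_n -> R) : R :=
  \big[Num.min/F (Ordinal n_gt0)]_(j < n) F j.

Definition maxI (F : 'I_n -> R) : R :=
  \big[Num.max/F (Ordinal n_gt0)]_(j < n) F j.

End FiniteExtrema.

Section Algorithm.
Context {R : realType} {d n : nat}.
Variable f : 'I_n -> 'rV[R]_d -> R.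

Definition average (x : 'rV[R]_d) : R := n%:R^-1 * \sum_(j < n) f j x.

Record state := State {
  iterate : 'rV[R]_d ;         (* x^k *)
  anchor : 'I_n -> 'rV[R]_d    (* phi_j^k *)
}.

Definition init (x0 : 'rV[R]_d) : state := State x0 (fun=> x0).

Definition anchor_grad (s : state) : 'rV[R]_d :=
  n%:R^-1 *: \sum_(j < n) grad (f j) (anchor s j).

(* The outcome [c = true] of the coin is the one of probability [delta]. *)
Definition estimator (delta : R) (c : bool) (s : state) : 'rV[R]_d :=
  if c then delta^-1 *: grad average (iterate s)
              - (delta^-1 - 1) *: anchor_grad s
  else anchor_grad s.

Definition lsvrg_inv_step (psi : 'rV[R]_d -> \bar R) (delta alpha : R)
    (c : bool) (S : {set 'I_n}) (s : state) : state :=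
  State (prox alpha psi (iterate s - alpha *: estimator delta c s))
        (fun j => if j \in S then iterate s else anchor s j).

Fixpoint lsvrg_inv (psi : 'rV[R]_d -> \bar R) (delta alpha : R)
    (x0 : 'rV[R]_d) (c : nat -> bool) (S : nat -> {set 'I_n}) (k : nat)
    : state :=
  if k is k'.+1 then
    lsvrg_inv_step psi delta alpha (c k') (S k')
      (lsvrg_inv psi delta alpha x0 c S k')
  else init x0.

Definition lyapunov (alpha m : R) (b : 'I_n -> R) (xstar : 'rV[R]_d)
    (s : state) : R :=
  sqnorm (iterate s - xstar)
  + alpha / m * \sum_(j < n) b j ^+ 2
      * sqnorm (grad (f j) (anchor s j) - grad (f j) xstar).

End Algorithm.

Section Randomness.
Context {R : realType} {dO : measure_display} {Omega : measurableType dO}.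
Variable P : probability Omega R.

(* Measurability with respect to the discrete sigma-algebra on [T]. *)
Definition discretely_measurable (T : Type) (X : Omega -> T) :=
  forall A : set T, measurable (X @^-1` A).

Definition same_distribution (T : Type) (X Y : Omega -> T) :=
  forall A : set T, P (X @^-1` A) = P (Y @^-1` A).

Definition mutually_independent (I : eqType) (T : I -> Type)
    (X : forall i, Omega -> T i) :=
  forall (J : seq I) (A : forall i, set (T i)), uniq J ->
    P (\bigcap_(i in [set` J]) (X i @^-1` A i))
    = (\prod_(i <- J) P (X i @^-1` A i))%E.

Definition inclusion_prob (n : nat) (S : Omega -> {set 'I_n}) (j : 'I_n) : R :=
  fine (P [set w | j \in S w]).

Definition draw_type (n : nat) (i : nat + nat) : Type :=
  match i with inl _ => bool | inr _ => {set 'I_n} end.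

(* The coins and the samples of all iterations, as a single family. *)
Definition draws (n : nat) (c : nat -> Omega -> bool)
    (S : nat -> Omega -> {set 'I_n}) (i : nat + nat) :
    Omega -> draw_type n i :=
  match i return Omega -> draw_type n i with
  | inl k => c k
  | inr k => S k
  end.

End Randomness.

(* Main.v *)
(* One step of LSVRG-inv contracts the Lyapunov function in expectation by the
   factor [1 - alpha * sigma] when [b_j ^ 2 = 1 / (2 n p_j)]. The estimator is
   unbiased with variance controlled by the squared gradient differences at the
   iterate and at the anchors; nonexpansiveness of the proximal operator, quasi
   strong convexity and cocoercivity of each gradient produce
   [- |grad f_j x - grad f_j xstar| ^ 2] terms, which absorb both that variance
   and the refreshed anchors. Since the draws up to step [k] take finitely many
   values, expectations are finite sums, factorized by independence. The minimum
   defining [alpha] is attained, so [rate * alpha * sigma >= 1], and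
   [(1 - alpha * sigma) ^ k <= exp (- k alpha sigma) <= eps]. *)
Require Import Defs.
From mathcomp Require Import all_boot all_order all_algebra.
From mathcomp Require Import all_classical all_reals all_analysis.
From mathcomp Require Import measurable_realfun ring lra.

Set Implicit Arguments.
Unset Strict Implicit.
Unset Printing Implicit Defensive.
Import Order.TTheory GRing.Theory Num.Theory.
Import numFieldNormedType.Exports.

Local Open Scope classical_set_scope.
Local Open Scope ring_scope.

(** * Euclidean inner product and squared norm on row vectors *)

Section EuclideanSpace.
Context {R : realType} {d : nat}.
Implicit Types (x y z : 'rV[R]_d) (a : R).

Lemma dotprodC x y : dotprod x y = dotprod y x.
Proof. by apply: eq_bigr => i _; rewrite mulrC. Qed.

Lemma dotprodDl x y z : dotprod (x + y) z = dotprod x z + dotprod y z.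
Proof. by rewrite -big_split; apply: eq_bigr => i _; rewrite !mxE mulrDl. Qed.

Lemma dotprodZl a x y : dotprod (a *: x) y = a * dotprod x y.
Proof. by rewrite mulr_sumr; apply: eq_bigr => i _; rewrite !mxE mulrA. Qed.

Lemma dotprodNl x y : dotprod (- x) y = - dotprod x y.
Proof. by rewrite -scaleN1r dotprodZl mulN1r. Qed.

Lemma dotprodDr x y z : dotprod z (x + y) = dotprod z x + dotprod z y.
Proof. by rewrite dotprodC dotprodDl !(dotprodC z). Qed.

Lemma dotprodZr a x y : dotprod x (a *: y) = a * dotprod x y.
Proof. by rewrite dotprodC dotprodZl dotprodC. Qed.

Lemma dotprodNr x y : dotprod x (- y) = - dotprod x y.
Proof. by rewrite dotprodC dotprodNl dotprodC. Qed.

Definition dotprodE :=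
  (dotprodDl, dotprodDr, dotprodNl, dotprodNr, dotprodZl, dotprodZr).

Lemma dotprod_suml n (F : 'I_n -> 'rV[R]_d) y :
  dotprod (\sum_j F j) y = \sum_j dotprod (F j) y.
Proof.
rewrite /dotprod exchange_big; apply: eq_bigr => i _.
by rewrite summxE mulr_suml.
Qed.

Lemma sqnorm_ge0 x : 0 <= sqnorm x.
Proof. by apply: sumr_ge0 => i _; rewrite -expr2 sqr_ge0. Qed.

Lemma sqnormE x : dotprod x x = sqnorm x. Proof. by []. Qed.

Lemma sqnormD x y : sqnorm (x + y) = sqnorm x + 2 * dotprod x y + sqnorm y.
Proof. by rewrite /sqnorm !dotprodE (dotprodC y x); lra. Qed.

Lemma sqnormB x y : sqnorm (x - y) = sqnorm x - 2 * dotprod x y + sqnorm y.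
Proof. by rewrite /sqnorm !dotprodE (dotprodC y x); lra. Qed.

Lemma sqnormN x : sqnorm (- x) = sqnorm x.
Proof. by rewrite /sqnorm !dotprodE opprK. Qed.

Lemma sqnormZ a x : sqnorm (a *: x) = a ^+ 2 * sqnorm x.
Proof. by rewrite /sqnorm !dotprodE mulrA. Qed.

Lemma coord_sqr_le x i : x 0 i ^+ 2 <= sqnorm x.
Proof.
rewrite /sqnorm /dotprod (bigD1 i) //= -expr2 lerDl.
by apply: sumr_ge0 => k _; rewrite -expr2 sqr_ge0.
Qed.

(** Jensen's inequality for the squared norm: the gap between the two sides is the mean squared
    deviation of the [F j] from their mean [h], which is nonnegative. *)
Lemma sqnorm_average n (F : 'I_n -> 'rV[R]_d) : (0 < n)%N ->
  sqnorm (n%:R^-1 *: \sum_j F j) <= n%:R^-1 * \sum_j sqnorm (F j).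
Proof.
move=> n0; set h := n%:R^-1 *: _.
have N0 : n%:R != 0 :> R by rewrite pnatr_eq0 -lt0n.
have sumF : \sum_j F j = n%:R *: h by rewrite scalerA divff // scale1r.
have : 0 <= \sum_j sqnorm (F j - h).
  by apply: sumr_ge0 => j _; exact: sqnorm_ge0.
under eq_bigr do rewrite sqnormB.
rewrite big_split sumrB -mulr_sumr -dotprod_suml sumF dotprodZl sqnormE /=.
rewrite sumr_const card_ord -mulr_natl => H.
rewrite ler_pdivlMl ?ltr0n //; lra.
Qed.

Lemma sqnorm_continuous : continuous (@sqnorm R d).
Proof.
move=> y; apply: (@cvg_big _ _ _ _ _ add_continuous _ (nbhs y)) => i _.
by apply: cvgM; exact: coord_continuous.
Qed.

End EuclideanSpace.

(** * Gradients of convex and of smooth functions *)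

Section Gradient.
Context {R : realType} {d : nat}.
Implicit Types (f : 'rV[R]_d -> R) (x y v : 'rV[R]_d).

Lemma derive_dotprod f x v : differentiable f x ->
  'D_v f x = dotprod (grad f x) v.
Proof.
move=> df; rewrite deriveE // {1}(row_sum_delta v) linear_sum /=.
apply: eq_bigr => i _; rewrite linearZ /= mxE deriveE //.
by rewrite mulrC.
Qed.

Lemma grad_average n (f : 'I_n -> 'rV[R]_d -> R) x :
  (forall j, differentiable (f j) x) ->
  grad (average f) x = n%:R^-1 *: \sum_j grad (f j) x.
Proof.
move=> df; apply/rowP => i; rewrite !mxE summxE.
have dv j v : derivable (f j) x v by exact: diff_derivable.
have -> : average f = n%:R^-1 \*: (\sum_j f j).
  by apply/funext => y; rewrite /average /= fct_sumE.
rewrite deriveZ; last exact: derivable_sum.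
rewrite derive_sum //; congr (_ * _).
by apply: eq_bigr => j _; rewrite mxE.
Qed.

(** By convexity, the difference quotient at [x] along [y - x] with step [0 < h < 1] is at most
    [f y - f x]; the bound survives the limit as [h] tends to 0 from the right. *)
Lemma convex_grad_le f x y : differentiable f x -> convex_function setT f ->
  f x + dotprod (grad f x) (y - x) <= f y.
Proof.
move=> df cf; rewrite -lerBrDl -derive_dotprod //.
have dv : derivable f x (y - x) by exact: diff_derivable.
apply: (ler_cvg_to (g := cst (f y - f x)) (cvg_dnbhs_at_right dv) (cvg_cst _)).
near=> h => /=.
have h0 : 0 < h by near: h; exact: nbhs_right_gt.
have h1 : h < 1 by near: h; exact: nbhs_right_lt.
have := cf (Itv01 (ltW h0) (ltW h1)) y x (in_setT _) (in_setT _).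
rewrite convRE /conv /= => H.
rewrite /GRing.scale /= ler_pdivrMl //.
suff -> : h *: (y - x) + x = h *: y + (1 - h) *: x.
  move: H; rewrite /unstable.onem => H; lra.
by rewrite scalerBl scale1r scalerBr addrAC -addrA addrC.
Unshelve. all: by end_near.
Qed.

Lemma smooth_convex_grad_le f (m : R) x y : 0 < m -> differentiable f y ->
  convex_function setT f -> smooth m f ->
  f y + dotprod (grad f y) (x - y)
    + (2 * m)^-1 * sqnorm (grad f x - grad f y) <= f x.
Proof.
move=> m0 df cf sf; set g := grad f x - grad f y.
(* a gradient step of length [1 / m] from [x] on the tilted function
   [f - <grad f y, .>], whose minimum is at [y] *)
pose z := x - m^-1 *: g.
have lo := convex_grad_le z df cf; have up := sf z x.
have zx : z - x = - (m^-1 *: g) by rewrite /z addrC addKr.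
have zy : z - y = (x - y) - m^-1 *: g by rewrite /z addrAC.
move: lo up; rewrite zx zy sqnormN sqnormZ dotprodDr !dotprodNr !dotprodZr.
have -> : m / 2 * (m^-1 ^+ 2 * sqnorm g) = (2 * m)^-1 * sqnorm g.
  by field; rewrite gt_eqF.
have gg : m^-1 * dotprod (grad f x) g - m^-1 * dotprod (grad f y) g
    = 2 * ((2 * m)^-1 * sqnorm g).
  rewrite -mulrBr -dotprodNl -dotprodDl sqnormE; field; by rewrite gt_eqF.
lra.
Qed.

Lemma smooth_average n (f : 'I_n -> 'rV[R]_d -> R) (m : R) : (0 < n)%N ->
  (forall j x, differentiable (f j) x) -> (forall j, smooth m (f j)) ->
  smooth m (average f).
Proof.
move=> n0 df sf x y; rewrite grad_average // dotprodZl dotprod_suml /average.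
have N0 : 0 < n%:R :> R by rewrite ltr0n.
rewrite -mulrDr -lerBlDl -mulrBr ler_pdivrMl // lerBlDl -big_split /=.
have -> : n%:R * (m / 2 * sqnorm (x - y)) = \sum_(j < n) m / 2 * sqnorm (x - y).
  by rewrite sumr_const card_ord mulr_natl.
by rewrite -big_split; apply: ler_sum => j _; exact: sf.
Qed.

End Gradient.

(** * Optimality conditions for composite minimization, and the proximal operator *)

Section Composite.
Context {R : realType} {d : nat}.
Variable psi : 'rV[R]_d -> \bar R.
Hypotheses (psi_proper : proper_function psi) (psi_convex : econvex psi).
Implicit Types (u v x g : 'rV[R]_d) (h : 'rV[R]_d -> R).

Lemma argmin_composite_fin h (a : R) u : 0 < a ->
  argmin (fun x => a%:E * psi x + (h x)%:E)%E u -> psi u \is a fin_num.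
Proof.
case: psi_proper => psiNy [v psiv] a0 /(_ v).
move: (psiNy u); case: (psi u) => [r| |] //= _.
move: (psiNy v) psiv; case: (psi v) => [s| |] //= _ _.
by rewrite gt0_muley ?lte_fin.
Qed.

(** First-order optimality: compare [u] with the points of the segment towards [v], divide by [t]
    and let [t] tend to 0. Only a quadratic upper bound on [h] along the segment is required, so
    that the lemma serves both the smooth average and the quadratic term of [prox]. *)
Lemma argmin_composite_subgrad h (a C : R) g u v : 0 < a ->
  argmin (fun x => a%:E * psi x + (h x)%:E)%E u ->
  (forall t, 0 < t < 1 -> h (t *: v + (1 - t) *: u)
     <= h u + t * dotprod g (v - u) + t ^+ 2 * C) ->
  (a%:E * psi u <= a%:E * psi v + (dotprod g (v - u))%:E)%E.
Proof.
move=> a0 umin hC; have := argmin_composite_fin a0 umin.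
have [psiNy _] := psi_proper.
have := psi_convex v u; have := psiNy v.
have Fmin t := umin (t *: v + (1 - t) *: u); move: Fmin => /=.
case: (psi u) => [r| |] //; case: (psi v) => [s| |] // Fmin _ cvx _; last first.
  by rewrite gt0_muley ?lte_fin // leey.
set D := dotprod _ _ in hC *; rewrite -!EFinM -EFinD lee_fin -subr_ge0.
set E := a * s + D - a * r.
have Ele t : 0 < t < 1 -> 0 <= E + t * C.
  move=> t01; have := Fmin t; have := cvx t t01; have := hC t t01.
  have t0 : 0 < t by case/andP: t01.
  move: (psiNy (t *: v + (1 - t) *: u)); case: (psi _) => [q| |] // _.
  rewrite -!EFinM -!EFinD !lee_fin -(ler_pM2l a0) => H1 H2 H3.
  rewrite -(pmulr_rge0 _ t0) /E; lra.
rewrite leNgt; apply/negP => E0.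
(* If [E < 0], this value of [t] lies strictly between 0 and 1 and is small enough to make
   [E + t * C] negative. *)
have := Ele (- E / (- E + `|C| + 1)).
have C0 := normr_ge0 C; have CC := ler_norm C.
have den : 0 < - E + `|C| + 1 by lra.
rewrite divr_gt0 ?oppr_gt0 //= ltr_pdivrMr // mul1r => /(_ _) H.
have /H : - E < - E + `|C| + 1 by lra.
rewrite -(pmulr_rge0 _ den) mulrDr mulrA mulrCA divff ?gt_eqF // mulr1 => K.
nra.
Qed.

Lemma box_compact x (r : R) :
  compact [set u : 'rV[R]_d | forall i, u 0 i \in `[x 0 i - r, x 0 i + r]].
Proof.
apply: (@rV_compact _ _ (fun i => `[x 0 i - r, x 0 i + r]%classic)) => i.
exact: segment_compact.
Qed.

(** Existence of the proximal point. Minimizing the continuous real function [G] over the epigraph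
    of [psi], which is closed, avoids extended values. The affine minorant of [psi] bounds the
    sublevel set [K], so the extreme value theorem applies. *)
Lemma prox_argmin (a b : R) g x : 0 < a -> closed_function psi ->
  (forall v, ((b + dotprod g v)%:E <= psi v)%E) ->
  argmin (fun u => a%:E * psi u + (2^-1 * sqnorm (u - x))%:E)%E
    (prox a psi x).
Proof.
move=> a0 psi_closed psi_ge.
have [psiNy [v0]] := psi_proper.
case E0 : (psi v0) (psiNy v0) => [s0| |] // _ _.
pose G (z : 'rV[R]_d * R) := a * z.2 + 2^-1 * sqnorm (z.1 - x).
pose C := G (v0, s0).
pose K := [set z : 'rV[R]_d * R | (psi z.1 <= z.2%:E)%E] `&` [set z | G z <= C].
have cG : continuous G.
  move=> z; apply: cvgD; first by apply: cvgM; [exact: cvg_cst|exact: cvg_snd].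
  apply: cvgM; first exact: cvg_cst.
  apply: continuous_comp; last exact: sqnorm_continuous.
  by apply: cvgB; [exact: cvg_fst|exact: cvg_cst].
have clK : closed K.
  apply: closedI => //.
  by apply: (@preimage_closed _ _ G [set r | r <= C]); [move=> z _; exact: cG|
    exact: closed_le].
(* Inserting the affine minorant into [G <= C] bounds half of [sqnorm (u - x)] up to a linear term;
   expanding the square of [(u - x) + (2 * a) *: g] absorbs that term at the cost of a quarter of
   [sqnorm (u - x)]. *)
pose B := 4 * (C - a * b - a * dotprod g x + a ^+ 2 * sqnorm g).
have bndK u t : K (u, t) -> sqnorm (u - x) <= B /\ t <= C / a.
  move=> [/= psiu Gu]; rewrite /G /= in Gu.
  have : b + dotprod g u <= t by rewrite -lee_fin (le_trans _ psiu).
  have -> : dotprod g u = dotprod g (u - x) + dotprod g x.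
    by rewrite -dotprodDr subrK.
  rewrite -(ler_pM2l a0) => at_ge; split.
    have := sqnorm_ge0 ((u - x) + (2 * a) *: g).
    rewrite sqnormD dotprodZr sqnormZ (dotprodC (u - x)) /B; nra.
  by rewrite ler_pdivlMr //; have := sqnorm_ge0 (u - x); nra.
have bndK' u t : K (u, t) ->
    b + dotprod g x - (sqnorm g + B) <= t.
  move=> Kut; have [uB _] := bndK _ _ Kut; case: Kut => /= psiu _.
  have : b + dotprod g u <= t by rewrite -lee_fin (le_trans _ psiu).
  have -> : dotprod g u = dotprod g (u - x) + dotprod g x.
    by rewrite -dotprodDr subrK.
  have := sqnorm_ge0 ((u - x) + g); rewrite sqnormD (dotprodC (u - x)).
  have := sqnorm_ge0 g; have := sqnorm_ge0 (u - x); lra.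
have K0 : K (v0, s0) by split => /=; rewrite ?E0.
have cptK : compact K.
  apply: subclosed_compact clK (compact_setX (@box_compact x (1 + B))
    (@segment_compact _ (b + dotprod g x - (sqnorm g + B)) (C / a))) _.
  move=> [u t] Kut; have [uB tC] := bndK _ _ Kut; split => /=; last first.
    by rewrite in_itv /= tC (bndK' u).
  move=> i; rewrite in_itv /=.
  have := le_trans (coord_sqr_le (u - x) i) uB; rewrite !mxE => H.
  (* A real number is bounded in absolute value by 1 plus its square, hence the box radius [1 + B]
     without a square root. *)
  have := sqr_ge0 (u 0 i - x 0 i + 1); have := sqr_ge0 (u 0 i - x 0 i - 1).
  by rewrite !expr2 in H *; move=> *; apply/andP; split; nra.
have [|[u t]] := @compact_EVT_min _ R G K _ cptK (continuous_subspaceT cG).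
  by exists (v0, s0).
rewrite inE => Kut Gmin.
suff umin : argmin (fun u => a%:E * psi u + (2^-1 * sqnorm (u - x))%:E)%E u.
  exact: (xgetI 0 umin).
have [/= psiut GutC] := Kut.
have Gle : (a%:E * psi u + (2^-1 * sqnorm (u - x))%:E <= (G (u, t))%:E)%E.
  by rewrite /G /= EFinD leeD2r // EFinM lee_pmul2l // lte_fin.
move=> v; apply: le_trans Gle _.
case Ev : (psi v) (psiNy v) => [s| |] // _; last first.
  by rewrite gt0_muley ?lte_fin // leey.
rewrite -EFinM -EFinD lee_fin.
(* Outside the sublevel set the value already exceeds [C], which bounds [G (u, t)]. *)
have [Gv|/ltW Gv] := leP (G (v, s)) C; last exact: le_trans GutC Gv.
by apply: (Gmin (v, s)); rewrite inE; split => //=; rewrite Ev.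
Qed.

(* The inequality assumed of [xs] says that [- g] is a subgradient of [psi] at
   [xs], i.e. that [xs] is the proximal point of [xs - a *: g], so this is the
   nonexpansiveness of [prox]. *)
Lemma prox_dist (a : R) g xs x : 0 < a -> closed_function psi ->
  psi xs \is a fin_num ->
  (forall v, (psi xs <= psi v + (dotprod g (v - xs))%:E)%E) ->
  sqnorm (prox a psi x - xs) <= sqnorm (x + a *: g - xs).
Proof.
move=> a0 psi_closed xs_fin xs_sub; set u := prox a psi x.
have := xs_fin; case Es : (psi xs) => [r| |] // _.
have umin : argmin (fun u => a%:E * psi u + (2^-1 * sqnorm (u - x))%:E)%E u.
  (* The subgradient inequality at [xs] supplies the affine minorant. *)
  apply: (@prox_argmin a (r + dotprod g xs) (- g)) => // v.
  have := xs_sub v; rewrite Es; case: (psi v) (psi_proper.1 v) => [s| |] // _;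
    last by move=> _; exact: leey.
  by rewrite -EFinD !lee_fin dotprodDr !dotprodNr dotprodNl; lra.
have := argmin_composite_fin a0 umin; case Eu : (psi u) => [q| |] // _.
have := xs_sub u; rewrite Es Eu -EFinD lee_fin => H1.
have := @argmin_composite_subgrad (fun u => 2^-1 * sqnorm (u - x)) a
  (2^-1 * sqnorm (xs - u)) (u - x) u xs a0 umin.
rewrite Es Eu; rewrite -!EFinM -EFinD lee_fin => H2.
have {H2} : a * q <= a * r + dotprod (u - x) (xs - u).
  apply: H2 => t _.
  have -> : t *: xs + (1 - t) *: u - x = (u - x) + t *: (xs - u).
    by rewrite scalerBl scale1r scalerBr; apply/rowP => i; rewrite !mxE; ring.
  by rewrite sqnormD dotprodZr sqnormZ; lra.
rewrite -(ler_pM2l a0) in H1.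
(* Adding the two subgradient inequalities, at [xs] and at [u], shows that the cross term of this
   decomposition is nonnegative. *)
have -> : x + a *: g - xs = (x - u + a *: g) + (u - xs).
  by apply/rowP => i; rewrite !mxE; ring.
rewrite (sqnormD (x - u + _)) (dotprodDl (x - u)) dotprodZl.
have -> : xs - u = - (u - xs) by rewrite opprB.
have -> : u - x = - (x - u) by rewrite opprB.
rewrite dotprodNr dotprodNl opprK.
have := sqnorm_ge0 (x - u + a *: g); lra.
Qed.

End Composite.

(** * Expected decrease of the Lyapunov function over one step *)

Section OneStep.
Context {R : realType} {d n : nat}.
Variables (n_gt0 : (0 < n)%N) (f : 'I_n -> 'rV[R]_d -> R).
Variables (psi : 'rV[R]_d -> \bar R) (xstar : 'rV[R]_d) (sigma m : R).
Hypotheses (f_diff : forall j x, differentiable (f j) x)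
  (f_convex : forall j, convex_function setT (f j))
  (psi_proper : proper_function psi) (psi_closed : closed_function psi)
  (psi_convex : econvex psi)
  (xstar_min : argmin (fun x => (average f x)%:E + psi x)%E xstar)
  (sigma_gt0 : 0 < sigma)
  (f_qsc : quasi_strongly_convex sigma (average f) xstar)
  (m_gt0 : 0 < m) (f_smooth : forall j, smooth m (f j)).

Lemma xstar_argmin1 :
  argmin (fun x => 1%:E * psi x + (average f x)%:E)%E xstar.
Proof. by move=> v; rewrite !mul1e !(addeC (psi _)); exact: xstar_min. Qed.

Lemma psi_xstar_fin : psi xstar \is a fin_num.
Proof. exact: argmin_composite_fin psi_proper _ _ _ ltr01 xstar_argmin1. Qed.

(** The optimality condition at [xstar]; smoothness of the average, taken at [xstar], is the
    required quadratic bound. *)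
Lemma psi_xstar_subgrad v :
  (psi xstar <= psi v + (dotprod (grad (average f) xstar) (v - xstar))%:E)%E.
Proof.
have sm := smooth_average n_gt0 f_diff f_smooth.
rewrite -[psi xstar]mul1e -[psi v]mul1e.
apply: (argmin_composite_subgrad psi_proper psi_convex
  (C := m / 2 * sqnorm (v - xstar)) ltr01 xstar_argmin1) => t _.
have := sm (t *: v + (1 - t) *: xstar) xstar.
have -> : t *: v + (1 - t) *: xstar - xstar = t *: (v - xstar).
  by apply/rowP => i; rewrite !mxE; ring.
by rewrite dotprodZr sqnormZ; lra.
Qed.

(** Sum of two inequalities: quasi strong convexity at [x], and the average over [j] of the lower
    bounds of [smooth_convex_grad_le] based at [xstar]. *)
Lemma average_monotone x :
  sigma / 2 * sqnorm (x - xstar)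
    + (2 * m)^-1 * (n%:R^-1
        * \sum_j sqnorm (grad (f j) x - grad (f j) xstar))
  <= dotprod (grad (average f) x - grad (average f) xstar) (x - xstar).
Proof.
have := f_qsc x; rewrite -(opprB x xstar) dotprodNr.
have N0 : 0 < n%:R^-1 :> R by rewrite invr_gt0 ltr0n.
have : average f xstar + dotprod (grad (average f) xstar) (x - xstar)
    + (2 * m)^-1 * (n%:R^-1
        * \sum_j sqnorm (grad (f j) x - grad (f j) xstar)) <= average f x.
  rewrite grad_average // dotprodZl dotprod_suml mulrCA /average.
  rewrite -!mulrDr ler_pM2l // mulr_sumr -!big_split.
  apply: ler_sum => j _; exact: smooth_convex_grad_le.
rewrite dotprodDl dotprodNl; lra.
Qed.

Variables (delta alpha : R).
Hypotheses (delta_gt0 : 0 < delta) (delta_le1 : delta <= 1)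
  (alpha_gt0 : 0 < alpha).

Lemma iterate_expected_dist (s : state (R := R) (d := d) (n := n)) T :
  let next b := iterate (lsvrg_inv_step f psi delta alpha b T s) in
  delta * sqnorm (next true - xstar) + (1 - delta) * sqnorm (next false - xstar)
  <= (1 - alpha * sigma) * sqnorm (iterate s - xstar)
    + alpha / m * (n%:R^-1 * \sum_j
      (2 * (alpha * m / delta)
         * (sqnorm (grad (f j) (iterate s) - grad (f j) xstar)
          + sqnorm (grad (f j) (anchor s j) - grad (f j) xstar))
        - sqnorm (grad (f j) (iterate s) - grad (f j) xstar))).
Proof.
case: s => x phi /=.
set g := grad (average f) xstar; set e := x - xstar.
pose a := grad (average f) x - g.
pose H := n%:R^-1 *: \sum_j grad (f j) (phi j).
(* [h] and [q] are the deviations of the estimator from the gradient at [xstar], for the coin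
   outcomes false and true. *)
pose h := H - g.
pose q := delta^-1 *: a - (delta^-1 - 1) *: h.
have psi_sub := psi_xstar_subgrad; rewrite -/g in psi_sub.
have nextP b : sqnorm (prox alpha psi
      (x - alpha *: estimator f delta b (State x phi)) - xstar)
    <= sqnorm (e - alpha *: (if b then q else h)).
  apply: le_trans (prox_dist psi_proper psi_convex _ alpha_gt0 psi_closed
    psi_xstar_fin psi_sub) _.
  rewrite le_eqVlt; apply/orP; left; apply/eqP; congr sqnorm.
  apply/rowP => i; rewrite /e /q /h /a /estimator /anchor_grad -/H.
  by case: b => /=; rewrite !mxE; ring.
have Dj : sqnorm a <= n%:R^-1
    * \sum_j sqnorm (grad (f j) x - grad (f j) xstar).
  by rewrite /a /g !grad_average // -scalerBr -sumrB; exact: sqnorm_average.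
have Ej : sqnorm h <= n%:R^-1
    * \sum_j sqnorm (grad (f j) (phi j) - grad (f j) xstar).
  by rewrite /h /H /g grad_average // -scalerBr -sumrB; exact: sqnorm_average.
have mono := average_monotone x; rewrite -/g -/a -/e in mono.
have /(ler_wpM2l (ltW delta_gt0)) nT := nextP true.
have d1 : 0 <= 1 - delta by rewrite subr_ge0.
have nF := ler_wpM2l d1 (nextP false).
apply: le_trans (lerD nT nF) _ => {nT nF nextP psi_sub}.
rewrite sumrB -mulr_sumr big_split /= (mulrBr n%:R^-1) (mulrCA n%:R^-1)
  (mulrDr n%:R^-1).
set D := n%:R^-1 * _ in mono Dj *; set E := n%:R^-1 * _ in Ej *.
have -> : sqnorm (e - alpha *: q) = sqnorm e - 2 * alpha *
    (delta^-1 * dotprod a e - (delta^-1 - 1) * dotprod h e)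
    + alpha ^+ 2 * sqnorm q.
  rewrite sqnormB sqnormZ dotprodZr /q dotprodDr dotprodNr !dotprodZr.
  by rewrite !(dotprodC e) mulrA.
have -> : sqnorm (e - alpha *: h) = sqnorm e - 2 * alpha * dotprod h e
    + alpha ^+ 2 * sqnorm h.
  by rewrite sqnormB sqnormZ dotprodZr (dotprodC e) mulrA.
(* Second moment of the estimator's deviation. After multiplication by [delta], the remaining cross
   term is controlled by [(1 - delta) * sqnorm (a + h) >= 0]. *)
have var : delta * sqnorm q + (1 - delta) * sqnorm h
    <= 2 / delta * (sqnorm a + sqnorm h).
  have := sqnorm_ge0 (a + h); rewrite sqnormD => ah0.
  have h0 := sqnorm_ge0 h; have a0 := sqnorm_ge0 a.
  rewrite /q sqnormB !sqnormZ dotprodZr dotprodZl.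
  have d0 : delta != 0 by rewrite gt_eqF.
  rewrite -(ler_pM2l delta_gt0).
  have -> : delta * (2 / delta * (sqnorm a + sqnorm h))
      = 2 * (sqnorm a + sqnorm h) by field.
  have -> : delta * (delta * (delta^-1 ^+ 2 * sqnorm a
        - 2 * ((delta^-1 - 1) * (delta^-1 * dotprod a h))
        + (delta^-1 - 1) ^+ 2 * sqnorm h) + (1 - delta) * sqnorm h)
      = sqnorm a - 2 * (1 - delta) * dotprod a h + (1 - delta) * sqnorm h.
    by field.
  have := mulr_ge0 d1 ah0; have := mulr_ge0 (ltW delta_gt0) h0.
  have := mulr_ge0 (ltW delta_gt0) a0; lra.
(* Unbiasedness: the anchor contributions cancel in the mean. *)
have cross : delta * (delta^-1 * dotprod a e - (delta^-1 - 1) * dotprod h e)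
    + (1 - delta) * dotprod h e = dotprod a e.
  by field; rewrite gt_eqF.
have var2 : 2 / delta * (sqnorm a + sqnorm h) <= 2 / delta * (D + E).
  by apply: ler_wpM2l; [rewrite divr_ge0 // ltW | exact: lerD].
have {var var2} var := ler_wpM2l (sqr_ge0 alpha) (le_trans var var2).
have {}mono := ler_wpM2l (ltW alpha_gt0) mono.
have -> : alpha / m * (2 * (alpha * m / delta) * (D + E) - D)
   = alpha ^+ 2 * (2 / delta * (D + E)) - 2 * (alpha * ((2 * m)^-1 * D)).
  by field; rewrite !gt_eqF.
have := congr1 (fun z => 2 * alpha * z) cross.
lra.
Qed.

Variables (p : 'I_n -> R) (r : {set 'I_n} -> R) (b : 'I_n -> R).
Hypotheses (p_gt0 : forall j, 0 < p j)
  (r_ge0 : forall T, 0 <= r T) (r_sum : \sum_T r T = 1)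
  (pE : forall j, p j = \sum_(T : {set 'I_n} | j \in T) r T)
  (alpha_le : forall j, alpha * (4 * (m / delta) + sigma / p j) <= 1)
  (bE : forall j, b j ^+ 2 = n%:R^-1 / (2 * p j)).

Lemma lyapunov_expected_decrease (s : state (R := R) (d := d) (n := n)) :
  \sum_T r T * (
      delta * lyapunov f alpha m b xstar
                (lsvrg_inv_step f psi delta alpha true T s)
    + (1 - delta) * lyapunov f alpha m b xstar
                (lsvrg_inv_step f psi delta alpha false T s))
  <= (1 - alpha * sigma) * lyapunov f alpha m b xstar s.
Proof.
pose next c T := lyapunov f alpha m b xstar
  (lsvrg_inv_step f psi delta alpha c T s).
change (\sum_T r T * (delta * next true T + (1 - delta) * next false T)
  <= (1 - alpha * sigma) * lyapunov f alpha m b xstar s).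
pose D j := sqnorm (grad (f j) (iterate s) - grad (f j) xstar).
pose E j := sqnorm (grad (f j) (anchor s j) - grad (f j) xstar).
have D0 j : 0 <= D j := sqnorm_ge0 _; have E0 j : 0 <= E j := sqnorm_ge0 _.
pose I := (1 - alpha * sigma) * sqnorm (iterate s - xstar)
  + alpha / m * (n%:R^-1 * \sum_j
    (2 * (alpha * m / delta) * (D j + E j) - D j)).
(* [I] bounds the expected iterate part and [M T] is the anchor part after the sample [T]; the
   latter does not depend on the coin, so [mix] adds it to both outcomes. *)
pose M (T : {set 'I_n}) := alpha / m * \sum_j
  b j ^+ 2 * (if j \in T then D j else E j).
have mix (X1 X2 J Y : R) : delta * X1 + (1 - delta) * X2 <= J ->
  delta * (X1 + Y) + (1 - delta) * (X2 + Y) <= J + Y by lra.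
have le1 T : delta * next true T + (1 - delta) * next false T <= I + M T.
  rewrite /next /lyapunov /=.
  have := iterate_expected_dist s T; rewrite -/(D _) -/(E _) -/I /=.
  have -> : alpha / m * \sum_j b j ^+ 2 * sqnorm (grad (f j)
      (if j \in T then iterate s else anchor s j) - grad (f j) xstar) = M T.
    by congr (_ * _); apply: eq_bigr => j _; case: ifP.
  exact: mix.
apply: (@le_trans _ _ (\sum_T r T * (I + M T))).
  by apply: ler_sum => T _; exact: ler_wpM2l.
have -> : \sum_T r T * (I + M T)
    = I + alpha / m * \sum_j b j ^+ 2 * (p j * D j + (1 - p j) * E j).
  under eq_bigr do rewrite mulrDr.
  rewrite big_split -mulr_suml r_sum mul1r /=; congr (_ + _).
  rewrite /M; under eq_bigr do rewrite mulrCA mulr_sumr.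
  rewrite -mulr_sumr exchange_big; congr (_ * _); apply: eq_bigr => j _ /=.
  under eq_bigr do rewrite mulrCA.
  rewrite -mulr_sumr; congr (_ * _).
  have -> : 1 - p j = \sum_(T : {set 'I_n} | j \notin T) r T.
    rewrite -r_sum (bigID (fun T : {set 'I_n} => j \in T)) /= -pE.
    by rewrite addrAC subrr add0r.
  rewrite pE !mulr_suml (bigID (fun T : {set 'I_n} => j \in T)) /=.
  by congr (_ + _); apply: eq_bigr => T; [move=> -> | move=> /negbTE ->].
rewrite /I /lyapunov (mulrDr (1 - _)) -addrA lerD2l (mulrCA (1 - _)).
rewrite -(mulrDr (alpha / m)) ler_pM2l ?divr_gt0 //.
rewrite !mulr_sumr -big_split; apply: ler_sum => j _ /=.
rewrite -/(E j) bE; have := alpha_le j; have := p_gt0 j.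
have N0 : 0 < n%:R^-1 :> R by rewrite invr_gt0 ltr0n.
set N := n%:R^-1 in N0 *; set P := p j => P0.
(* The claim is now checked index by index. The choice of [b] makes refreshed anchors cost
   [D j / 2]; what remains is [y <= 1 / 2] for the [D j] term and [y + u / 2 <= 1 / 2] for the [E j]
   term, both consequences of the stepsize bound [2 * y + u <= 1]. *)
pose y := 2 * (alpha * m / delta); pose u := alpha * sigma / P.
have -> : alpha * (4 * (m / delta) + sigma / P) = 2 * y + u.
  by rewrite /y /u; field; rewrite !gt_eqF.
rewrite -/y => yu.
have -> : N / (2 * P) * (P * D j + (1 - P) * E j)
    = N * (D j / 2 + (1 - P) / (2 * P) * E j) by field; rewrite gt_eqF.
have -> : (1 - alpha * sigma) * (N / (2 * P) * E j)
    = N * ((P^-1 / 2 - u / 2) * E j) by rewrite /u; field; rewrite gt_eqF.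
rewrite -mulrDr ler_pM2l //.
have -> : (1 - P) / (2 * P) = P^-1 / 2 - 1 / 2 by field; rewrite gt_eqF.
have u0 : 0 <= u by rewrite /u divr_ge0 ?mulr_ge0 // ltW.
have DD : 0 <= (1 / 2 - y) * D j by rewrite mulr_ge0 // subr_ge0; lra.
have EE : 0 <= (1 / 2 - u / 2 - y) * E j by rewrite mulr_ge0 // subr_ge0; lra.
move: (D j) (E j) DD EE => Dj Ej DD EE.
lra.
Qed.

End OneStep.

(** * Expectations of functions of a finitely valued random variable *)

Section DiscreteExpectation.
Context {R : realType} {dO : measure_display} {Omega : measurableType dO}.
Variable P : probability Omega R.

Definition pmass (T : Type) (X : Omega -> T) (t : T) : R :=
  fine (P (X @^-1` [set t])).

Lemma pmass_ge0 (T : Type) (X : Omega -> T) t : 0 <= pmass X t.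
Proof. exact: fine_ge0. Qed.

Lemma pmassE (T : Type) (X : Omega -> T) t : discretely_measurable X ->
  P (X @^-1` [set t]) = (pmass X t)%:E.
Proof. by move=> mX; rewrite /pmass fineK // fin_num_measure. Qed.

(** Along the level sets of [X], the function [F \o X] is a finite sum of weighted indicators;
    nonnegativity lets the integral pass through the sum. *)
Lemma expectation_finite (T : finType) (X : Omega -> T) (F : T -> R) :
  discretely_measurable X -> (forall t, 0 <= F t) ->
  ('E_P[F \o X] = (\sum_t pmass X t * F t)%R%:E)%E.
Proof.
move=> mX F0; rewrite unlock.
transitivity (\int[P]_w (\sum_(t : T) (F t * \1_(X @^-1` [set t]) w)%:E)%E)%E.
  apply: eq_integral => w _; rewrite sumEFin; congr EFin.
  rewrite /= (bigD1 (X w)) //= big1 ?addr0.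
    by rewrite indicE mem_set // mulr1.
  move=> t tX; rewrite indicE memNset ?mulr0 // => /= Xt.
  by rewrite Xt eqxx in tX.
rewrite ge0_integral_sum //; last 2 first.
- move=> t; apply/measurable_EFinP; exact: measurable_funM.
- by move=> t w _; rewrite lee_fin mulr_ge0.
rewrite -sumEFin; apply: eq_bigr => t _.
under eq_integral do rewrite EFinM.
rewrite ge0_integralZl_EFin //; last first.
  by apply/measurable_EFinP; apply: measurable_indic; exact: mX.
by rewrite integral_indic // setIT mulrC EFinM -pmassE.
Qed.

Lemma prob_finite (T : finType) (X : Omega -> T) (A : {pred T}) :
  discretely_measurable X ->
  fine (P [set w | A (X w)]) = \sum_(t | A t) pmass X t.
Proof.
move=> mX.
have mA : measurable [set w | A (X w)] by exact: (mX [set t | A t]).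
have := expectation_indic P mA.
have -> : \1_[set w | A (X w)] = (fun t => (A t)%:R) \o X :> (Omega -> R).
  apply/funext => w /=; rewrite indicE; congr (_ %:R); congr nat_of_bool.
  by apply/idP/idP => [|?]; [rewrite inE | rewrite inE].
rewrite expectation_finite // => <-; rewrite [RHS]big_mkcond /=.
by apply: eq_bigr => t _; case: (A t); rewrite ?mulr1 ?mulr0.
Qed.

Lemma pmass_sum (T : finType) (X : Omega -> T) : discretely_measurable X ->
  \sum_t pmass X t = 1.
Proof.
move=> mX; have := prob_finite predT mX.
have -> : [set w | predT (X w)] = setT by apply/seteqP; split.
by rewrite probability_setT.
Qed.

Lemma same_distribution_pmass (T : Type) (X Y : Omega -> T) t :
  same_distribution P X Y -> pmass X t = pmass Y t.
Proof. by move=> XY; rewrite /pmass XY. Qed.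

End DiscreteExpectation.

(** * The finite history of draws and its law under independence *)

Section History.
Context {R : realType} {dO : measure_display} {Omega : measurableType dO}.
Variables (P : probability Omega R) (n : nat).
Variables (c : nat -> Omega -> bool) (S : nat -> Omega -> {set 'I_n}).
Hypotheses (c_rv : forall k, discretely_measurable (c k))
  (S_rv : forall k, discretely_measurable (S k))
  (indep : mutually_independent P (draws c S)).

Fixpoint history (k : nat) : finType :=
  if k is k'.+1 then (history k' * (bool * {set 'I_n}))%type else unit.

Lemma sum_historyS k (F : history k.+1 -> R) :
  \sum_u F u
  = \sum_(u : history k) \sum_T (F (u, (true, T)) + F (u, (false, T))).
Proof.
transitivity (\sum_(u : history k) \sum_v F (u, v)).
  by rewrite pair_bigA; apply: eq_bigr => -[].
apply: eq_bigr => u _.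
transitivity (\sum_a \sum_T F (u, (a, T))).
  by rewrite pair_bigA; apply: eq_bigr => -[].
by rewrite big_bool /= -big_split.
Qed.

Fixpoint past (k : nat) (w : Omega) : history k :=
  if k is k'.+1 then (past k' w, (c k' w, S k' w)) else tt.

(** The value [true] is a filler for indices at least [k], which never occur in [past_indices k];
    likewise the empty set in [past_set]. *)
Fixpoint past_coin (k : nat) : history k -> nat -> bool :=
  if k is k'.+1 then fun u i => if i == k' then u.2.1 else past_coin u.1 i
  else fun _ _ => true.

Fixpoint past_set (k : nat) : history k -> nat -> {set 'I_n} :=
  if k is k'.+1 then fun u i => if i == k' then u.2.2 else past_set u.1 i
  else fun _ _ => finset.set0.

(** Defined on the whole index type because independence is stated for a family of events over all
    draws, restricted afterwards to a finite list. *)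
Definition past_event (k : nat) (u : history k) (i : nat + nat) :
    set (draw_type n i) :=
  match i with
  | inl i => [set past_coin u i]
  | inr i => [set past_set u i]
  end.

Fixpoint past_indices (k : nat) : seq (nat + nat) :=
  if k is k'.+1 then [:: inl k', inr k' & past_indices k'] else [::].

Lemma mem_past_indices k i : (i \in past_indices k) =
  match i with inl i => (i < k)%N | inr i => (i < k)%N end.
Proof.
elim: k => [|k IH]; first by case: i.
by rewrite /= !inE IH; case: i {IH} => i; rewrite ltnS [RHS]leq_eqVlt.
Qed.

Lemma past_indices_uniq k : uniq (past_indices k).
Proof. by elim: k => //= k ->; rewrite !inE !mem_past_indices !ltnn. Qed.

Lemma past_eqP k (u : history k) w : past k w = u <->
  forall i, (i < k)%N -> c i w = past_coin u i /\ S i w = past_set u i.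
Proof.
elim: k u => [[]|k IH [u [b T]]] //=; split=> [[<- <- <-] i|H].
  rewrite ltnS leq_eqVlt; case: eqP => [->|] //= _ ik.
  by have /IH := erefl (past k w); exact.
have := H k (leqnn _); rewrite eqxx => -[-> ->]; congr pair.
apply/IH => i ik; have := H i (ltnW ik).
by rewrite ltn_eqF.
Qed.

Lemma past_preimage k (u : history k) : past k @^-1` [set u]
  = \bigcap_(i in [set` past_indices k]) (draws c S i @^-1` @past_event k u i).
Proof.
apply/seteqP; split => w /=.
  by move=> /past_eqP H [] i /=; rewrite mem_past_indices => /H [].
move=> H; apply/past_eqP => i ik.
by split; [apply: (H (inl i)) | apply: (H (inr i))];
  rewrite /= mem_past_indices.
Qed.

(** Each preimage is a finite union of fibres, and each fibre is a finite intersection of events on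
    single draws. *)
Lemma past_rv k : discretely_measurable (past k).
Proof.
move=> A; have -> : past k @^-1` A = \bigcup_(u in A) (past k @^-1` [set u]).
  by apply/seteqP; split => [w Aw|w [u Au /= ->]] //; exists (past k w).
apply: fin_bigcup_measurable; first exact: finite_finset.
move=> u _; rewrite past_preimage; apply: fin_bigcap_measurable => //.
by move=> [] i _ /=; [exact: c_rv | exact: S_rv].
Qed.

(** Independence is applied to the histories of lengths [k.+1] and [k]: the longer product has just
    the two factors of step [k] in addition, and the earlier factors coincide. *)
Lemma pmass_pastS k (u : history k) b T :
  pmass P (past k.+1) (u, (b, T))
  = pmass P (past k) u * (pmass P (c k) b * pmass P (S k) T).
Proof.
apply: EFin_inj; rewrite !EFinM -!pmassE //; try exact: past_rv.
rewrite !past_preimage !indep ?past_indices_uniq //= !big_cons /= eqxx.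
rewrite muleA muleC; congr (_ * _)%E.
by apply: eq_big_seq => -[] i; rewrite mem_past_indices /= => /ltn_eqF ->.
Qed.

End History.

(** * Finite minima and maxima *)

Section FiniteExtremaTheory.
Context {R : realType} {n : nat} (n_gt0 : (0 < n)%N).
Implicit Types F : 'I_n -> R.

Lemma minI_le F j : minI n_gt0 F <= F j.
Proof. exact: bigmin_le_cond. Qed.

Lemma le_maxI F j : F j <= maxI n_gt0 F.
Proof. exact: le_bigmax. Qed.

(** The fold starts from a value of [F], and a minimum of two values of [F] is one of them. *)
Lemma minI_attained F : exists j, minI n_gt0 F = F j.
Proof.
rewrite /minI; elim/big_ind: _ => [|x y [i ->] [j ->]|i _].
- by exists (Ordinal n_gt0).
- by rewrite /Order.min; case: ifP => _; [exists i | exists j].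
- by exists i.
Qed.

End FiniteExtremaTheory.

(** * From the one-step contraction to the iteration complexity *)

Lemma lyapunov_ge0 (R : realType) (d n : nat) (f : 'I_n -> 'rV[R]_d -> R)
    (alpha m : R) (b : 'I_n -> R) (xstar : 'rV[R]_d)
    (s : state (R := R) (d := d) (n := n)) :
  0 < alpha -> 0 < m -> 0 <= lyapunov f alpha m b xstar s.
Proof.
move=> a0 m0; rewrite addr_ge0 ?sqnorm_ge0 // mulr_ge0 //.
  by rewrite ltW // divr_gt0.
by apply: sumr_ge0 => j _; rewrite mulr_ge0 ?sqr_ge0 ?sqnorm_ge0.
Qed.

(** The algorithm replayed on a finite history, which makes its state a deterministic function of a
    finitely valued variable. *)
Fixpoint past_state (R : realType) (d n : nat) (f : 'I_n -> 'rV[R]_d -> R)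
    (psi : 'rV[R]_d -> \bar R) (delta alpha : R) (x0 : 'rV[R]_d) (k : nat) :
    history n k -> state (R := R) (d := d) (n := n) :=
  if k is k'.+1 then fun u => lsvrg_inv_step f psi delta alpha u.2.1 u.2.2
    (past_state f psi delta alpha x0 u.1)
  else fun=> init x0.

Lemma lsvrg_inv_past (R : realType) (d n : nat) (f : 'I_n -> 'rV[R]_d -> R)
    (psi : 'rV[R]_d -> \bar R) (delta alpha : R) (x0 : 'rV[R]_d)
    (dO : measure_display) (Omega : measurableType dO)
    (c : nat -> Omega -> bool) (S : nat -> Omega -> {set 'I_n})
    (k : nat) (w : Omega) :
  lsvrg_inv f psi delta alpha x0 (c ^~ w) (S ^~ w) k
  = past_state f psi delta alpha x0 (past c S k w).
Proof. by elim: k => //= k ->. Qed.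

Lemma expr_le_of_rate (R : realType) (q rate eps : R) (k : nat) :
  0 <= q -> q <= 1 -> 1 <= rate * q -> 0 < eps < 1 ->
  rate * ln (1 / eps) <= k%:R -> (1 - q) ^+ k <= eps.
Proof.
move=> q0 q1 rq /andP[e0 e1]; rewrite div1r lnV ?posrE // => kle.
have L0 : 0 < - ln eps by rewrite oppr_gt0 ln_lt0 // e0.
have : (1 - q) ^+ k <= expR (- q) ^+ k.
  by rewrite lerXn2r ?nnegrE ?subr_ge0 ?expR_ge0 // expR_ge1Dx.
move=> /le_trans; apply; rewrite -expRM_natl -[leRHS]lnK ?posrE // ler_expR.
nra.
Qed.

Theorem corollaryK2 (R : realType) (d n : nat) (n_gt0 : (0 < n)%N)
    (* the problem *)
    (f : 'I_n -> 'rV[R]_d -> R) (psi : 'rV[R]_d -> \bar R)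
    (xstar : 'rV[R]_d) (sigma m : R)
    (f_diff : forall j x, differentiable (f j) x)
    (f_convex : forall j, convex_function setT (f j))
    (psi_proper : proper_function psi) (psi_closed : closed_function psi)
    (psi_convex : econvex psi)
    (xstar_min : argmin (fun x => (average f x)%:E + psi x)%E = [set xstar])
    (sigma_gt0 : 0 < sigma)
    (f_qsc : quasi_strongly_convex sigma (average f) xstar)
    (m_gt0 : 0 < m) (f_smooth : forall j, smooth m (f j))
    (* the randomness: [RS] is the random set R, [c k] is the coin deciding
       between the two values of g^k, [S k] is R^k *)
    (dO : measure_display) (Omega : measurableType dO)
    (P : probability Omega R)
    (RS : Omega -> {set 'I_n}) (delta : R)
    (RS_rv : discretely_measurable RS)
    (p_gt0 : forall j, 0 < inclusion_prob P RS j)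
    (delta_gt0 : 0 < delta) (delta_le1 : delta <= 1)
    (c : nat -> Omega -> bool) (S : nat -> Omega -> {set 'I_n})
    (c_rv : forall k, discretely_measurable (c k))
    (S_rv : forall k, discretely_measurable (S k))
    (c_law : forall k, P [set w | c k w] = delta%:E)
    (S_law : forall k, same_distribution P (S k) RS)
    (indep : mutually_independent P (draws c S))
    (x0 : 'rV[R]_d) :
  let p := inclusion_prob P RS in
  let alpha := minI n_gt0 (fun j => 1 / (4 * (m / delta) + sigma / p j)) in
  let rate := maxI n_gt0 (fun j => 4 * (m / (sigma * delta)) + 1 / p j) in
  exists b : 'I_n -> R, (forall j, 0 < b j) /\
    let Psi (k : nat) (w : Omega) : R := lyapunov f alpha m b xstar
      (lsvrg_inv f psi delta alpha x0 (c ^~ w) (S ^~ w) k) in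
    let Psi0 : R := lyapunov f alpha m b xstar (init x0) in
    forall (eps : R) (k : nat), 0 < eps < 1 ->
      rate * ln (1 / eps) <= k%:R ->
      ('E_P[Psi k] <= (eps * Psi0)%:E)%E.
Proof.
move=> p alpha rate.
have [j0 alphaE] : exists j, alpha = 1 / (4 * (m / delta) + sigma / p j).
  exact: minI_attained.
have den_gt0 j : 0 < 4 * (m / delta) + sigma / p j.
  by rewrite addr_gt0 ?mulr_gt0 ?divr_gt0 ?invr_gt0 // p_gt0.
have alpha_gt0 : 0 < alpha by rewrite alphaE divr_gt0.
have alpha_le j : alpha * (4 * (m / delta) + sigma / p j) <= 1.
  by rewrite -ler_pdivlMr // minI_le.
pose b j := Num.sqrt (n%:R^-1 / (2 * p j)); exists b.
have N0 : 0 < n%:R^-1 :> R by rewrite invr_gt0 ltr0n.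
have b2_gt0 j : 0 < n%:R^-1 / (2 * p j).
  by rewrite divr_gt0 // mulr_gt0 // p_gt0.
split=> [j|Psi Psi0 eps k eps01 rate_le]; first by rewrite sqrtr_gt0.
have bE j : b j ^+ 2 = n%:R^-1 / (2 * p j) by rewrite sqr_sqrtr // ltW.
have xstar_argmin : argmin (fun x => (average f x)%:E + psi x)%E xstar.
  by rewrite xstar_min.
have pE j : p j = \sum_(T : {set 'I_n} | j \in T) pmass P RS T.
  exact: (prob_finite P (fun T : {set 'I_n} => j \in T) RS_rv).
have p_le1 j : p j <= 1.
  have mj : measurable [set w | j \in RS w] :=
    RS_rv [set T : {set 'I_n} | j \in T].
  rewrite -lee_fin /p /inclusion_prob fineK; last exact: fin_num_measure.
  exact: probability_le1.
pose st := past_state f psi delta alpha x0.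
pose V k := \sum_(u : history n k) pmass P (past c S k) u
  * lyapunov f alpha m b xstar (st k u).
have PsiV i : ('E_P[Psi i] = (V i)%:E)%E.
  rewrite -expectation_finite; last 2 first.
  - exact: past_rv.
  - by move=> u; exact: lyapunov_ge0.
  congr expectation; apply/funext => w /=.
  by rewrite /Psi lsvrg_inv_past.
have V0 : V 0%N = Psi0.
  have mass1 : \sum_(u : history n 0) pmass P (past c S 0%N) u = 1.
    by apply: pmass_sum; exact: past_rv.
  by rewrite -[RHS]mul1r -mass1 mulr_suml; exact: eq_bigr.
have coinT i : pmass P (c i) true = delta.
  rewrite /pmass (_ : c i @^-1` [set true] = [set w | c i w]) ?c_law //.
have coinF i : pmass P (c i) false = 1 - delta.
  by have := pmass_sum P (c_rv i); rewrite big_bool /= coinT => <-; ring.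
(* Since [p j0 <= 1], [sigma] is at most [sigma / p j0], a summand of the stepsize denominator. *)
have q1 : alpha * sigma <= 1.
  apply: le_trans (alpha_le j0); rewrite ler_pM2l //.
  rewrite -[leLHS]add0r lerD //; first by rewrite mulr_ge0 ?divr_ge0 ?ltW.
  by rewrite ler_pdivlMr ?p_gt0 // ler_piMr // ltW.
(* For each fixed history [u], its mass factors out and the sum over the new coin and sample is the
   conditional expectation bounded by the one-step lemma. *)
have VS i : V i.+1 <= (1 - alpha * sigma) * V i.
  rewrite {1}/V sum_historyS.
  rewrite mulr_sumr; apply: ler_sum => u _.
  rewrite mulrCA.
  have step := lyapunov_expected_decrease n_gt0 f_diff f_convex psi_proper
    psi_closed psi_convex xstar_argmin sigma_gt0 f_qsc m_gt0 f_smooth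
    delta_gt0 delta_le1 alpha_gt0 p_gt0 (pmass_ge0 P RS)
    (pmass_sum P RS_rv) pE alpha_le bE (st i u).
  apply: le_trans (ler_wpM2l (pmass_ge0 P _ u) step).
  rewrite le_eqVlt; apply/orP; left; apply/eqP.
  rewrite mulr_sumr; apply: eq_bigr => T _.
  rewrite !pmass_pastS // coinT coinF (same_distribution_pmass _ (S_law i)).
  set X1 := lyapunov _ _ _ _ _ _; set X2 := lyapunov _ _ _ _ _ _.
  by move: X1 X2 => X1 X2; ring.
rewrite PsiV lee_fin.
have : V k <= (1 - alpha * sigma) ^+ k * Psi0.
  elim: k {eps01 rate_le} => [|k IH]; first by rewrite V0 expr0 mul1r.
  apply: le_trans (VS k) _; rewrite exprS -mulrA ler_wpM2l // subr_ge0 //.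
move=> /le_trans; apply; rewrite ler_wpM2r //; first exact: lyapunov_ge0.
apply: (expr_le_of_rate _ q1 _ eps01 rate_le); first by rewrite ltW // mulr_gt0.
(* At the index [j0] attaining the stepsize, the term of the maximum equals
   [1 / (alpha * sigma)]. *)
rewrite -ler_pdivrMr ?mulr_gt0 //; apply: le_trans (le_maxI n_gt0 _ j0).
rewrite le_eqVlt; apply/orP; left; apply/eqP; rewrite alphaE.
have pj : 0 < p j0 := p_gt0 j0.
by field; rewrite !gt_eqF // addr_gt0 ?mulr_gt0.
Qed.
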